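(* Let $(X,d,\nu)$ be a compact geodesic metric measure space with a lower bound $\kappa$ of the coarse Ricci curvature associated with the $r$-step random walk, i.e. $\kappa(x,y)\ge\kappa$ for all $x,y\in X$, $x\neq y$. Assume that $X$ satisfies a Bishop-Gromov inequality, i.e. $[BG_{K,N}]$ for some real numbers $K$ and $N>1$. Then any eigenvalue $\lambda$ of the Laplacian $\Delta$ associated with the $r$-step random walk satisfies $$\kappa\le\lambda\le 2-\kappa.$$
   Context: A metric measure space $(X,d,\nu)$ is a complete separable metric space $(X,d)$ with a positive Radon measure $\nu$; $B_r(x)$ is the open ball of radius $r>0$ centered at $x$, and $0<\nu(B_r(x))<\infty$ for all $x\in X$, $r>0$. The space is geodesic if for any $x,y\in X$ there is a curve $\gamma:[0,1]\to X$ joining $x$ to $y$ with $d(\gamma(s),\gamma(t))=|s-t|\,d(x,y)$ for all $s,t\in[0,1]$. For real numbers $K$ and $N>1$, define $s_{K,N}:[0,\infty)\to\mathbb{R}$ by $s_{K,N}(t)=\sqrt{(N-1)/K}\,\sin(t\sqrt{K/(N-1)})$ if $K>0$, $s_{K,N}(t)=t$ if $K=0$, and $s_{K,N}(t)=\sqrt{(N-1)/(-K)}\,\sinh(t\sqrt{-K/(N-1)})$ if $K<0$. $(X,d,\nu)$ satisfies the Bishop-Gromov inequality $[BG_{K,N}]$ if for any $x\in X$ and any $0<r<R\le \pi\sqrt{(N-1)/\max\{K,0\}}$ (with the convention $1/0=\infty$), $$\frac{\nu(B_R(x))}{\nu(B_r(x))}\le\frac{\int_0^R s_{K,N}(t)^{N-1}dt}{\int_0^r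 s_{K,N}(t)^{N-1}dt}.$$ For $r>0$, the $r$-step random walk is the family of probability measures $m^r_x=\frac{\chi_{B_r(x)}}{\nu(B_r(x))}\nu$, $x\in X$, where $\chi_{B_r(x)}$ is the characteristic function of $B_r(x)$. The associated coarse Ricci curvature is $\kappa(x,y)=1-\frac{W_1(m^r_x,m^r_y)}{d(x,y)}$, where $W_1$ is the $L^1$-Wasserstein metric, $W_1(\mu,\mu')=\inf_{\xi}\int_{X\times X}d(x,y)\,d\xi(x,y)$, the infimum being over all couplings $\xi$ of $\mu$ and $\mu'$ (Borel probability measures on $X\times X$ with marginals $\mu$ and $\mu'$). The Laplacian of a function $f:X\to\mathbb{R}$ is $\Delta f(x)=f(x)-\int_X f(y)\,dm^r_x(y)$ for $x\in X$, whenever the right-hand side is defined. A real number $\lambda$ is an eigenvalue of the Laplacian if there is a function $f:X\to\mathbb{R}$, not identically zero, with $\Delta f=\lambda f$ on $X$.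
   Formalization: When κ > 0 the eigenvalue λ = 0 is excluded: constant functions always make 0 an eigenvalue, so the lower bound κ ≤ λ fails for it (e.g. on [0,1] with r = 2, where κ(x,y) = 1). *)

(* Defs.v *)
From HB Require Import structures.
From mathcomp Require Import all_boot all_order all_algebra.
From mathcomp Require Import all_classical all_reals all_analysis.

Set Implicit Arguments.
Unset Strict Implicit.
Unset Printing Implicit Defensive.

Import Order.TTheory GRing.Theory Num.Theory.
Import numFieldNormedType.Exports.

Local Open Scope classical_set_scope.
Local Open Scope ring_scope.

(* Measurable types are pointed in the library, so a metric space carrying a
   Borel sigma-algebra has to be given with a point, i.e. to be nonempty. *)
#[short(type="pmetricType")]
HB.structure Definition PointedMetric (R : numDomainType) :=
  {M of Metric R M & isPointed M}.

Notation borel T := (g_sigma_algebraType (@open T)).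

Section metric_measure_spaces.
Context {R : realType} {X : pmetricType R}.
Implicit Types (nu : {measure set (borel X) -> \bar R}).

Definition complete_space :=
  forall F : set_system X, ProperFilter F -> cauchy F -> cvg F.

Definition separable_space := exists S : set X, countable S /\ dense S.

Definition radon nu :=
  (forall C : set X, compact C -> (nu C < +oo)%E) /\
  (forall A : set (borel X), measurable A ->
    nu A = ereal_sup [set nu C | C in [set C : set X | compact C /\ C `<=` A]]).

Definition metric_measure_space nu :=
  [/\ complete_space, separable_space, radon nu &
      forall (x : X) (r : R), 0 < r ->
        (0 < nu (ball x r))%E /\ (nu (ball x r) < +oo)%E].

(* Only the values of gamma on [0, 1] matter. *)
Definition geodesic_space := forall x y : X, exists gamma : R -> X,
  [/\ gamma 0 = x, gamma 1 = y &
      forall s t : R, 0 <= s <= 1 -> 0 <= t <= 1 ->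
        mdist (gamma s) (gamma t) = `|s - t| * mdist x y].

End metric_measure_spaces.

Arguments complete_space {R} X.
Arguments separable_space {R} X.
Arguments geodesic_space {R} X.

Section bishop_gromov.
Context {R : realType}.

Definition sinhR (t : R) : R := (expR t - expR (- t)) / 2.

Definition model_s (K N t : R) : R :=
  if 0 < K then Num.sqrt ((N - 1) / K) * sin (t * Num.sqrt (K / (N - 1)))
  else if K == 0 then t
  else Num.sqrt ((N - 1) / - K) * sinhR (t * Num.sqrt (- K / (N - 1))).

(* pi * sqrt ((N - 1) / max (K, 0)), with 1 / 0 = +oo *)
Definition model_radius (K N : R) : \bar R :=
  if 0 < K then (pi * Num.sqrt ((N - 1) / K))%:E else +oo%E.

Definition model_volume (K N t : R) : R :=
  \int[@lebesgue_measure R]_(u in `[0, t]) (model_s K N u `^ (N - 1)).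

Definition bishop_gromov (X : pmetricType R)
    (nu : {measure set (borel X) -> \bar R}) (K N : R) :=
  forall (x : X) (r1 r2 : R), 0 < r1 -> r1 < r2 ->
    (r2%:E <= model_radius K N)%E ->
    fine (nu (ball x r2)) / fine (nu (ball x r1)) <=
    model_volume K N r2 / model_volume K N r1.

End bishop_gromov.

Section random_walk.
Context {R : realType} {X : pmetricType R}.

Lemma measurable_open_ball (x : X) (r : R) :
  measurable (ball x r : set (borel X)).
Proof.
apply: sub_sigma_algebra; rewrite openE => y /=; rewrite ballEmdist /= => xy.
apply/nbhs_ballP; exists (r - mdist x y); first by rewrite /= subr_gt0.
move=> z; rewrite ballEmdist /= ltrBrDl => yz.
by rewrite (le_lt_trans (metric_triangle x y z)).
Qed.

(* The normalized restriction of nu to the ball; the Dirac mass is only the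
   fallback value of mnormalize when the ball has measure 0 or +oo. *)
Definition random_walk (nu : {measure set (borel X) -> \bar R}) (r : R) (x : X)
    : probability (borel X) R :=
  mnormalize (mrestr nu (measurable_open_ball x r)) (dirac (x : borel X)).

Lemma random_walkE (nu : {measure set (borel X) -> \bar R}) (r : R) (x : X)
    (A : set (borel X)) :
  (0 < nu (ball x r))%E -> (nu (ball x r) < +oo)%E ->
  random_walk nu r x A =
  (nu (A `&` ball x r) * (fine (nu (ball x r)))^-1%:E)%E.
Proof.
move=> nu0 nuoo.
have E : mrestr nu (measurable_open_ball x r) setT = nu (ball x r).
  by rewrite /mrestr; congr (nu _); exact: setTI.
rewrite /random_walk /= /mnormalize; case: ifPn => [/orP[]/eqP nuB|_].
- by move: nu0; rewrite (etrans (esym E) nuB) ltxx.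
- by move: nuoo; rewrite (etrans (esym E) nuB) ltxx.
- by congr (_ * (fine _)^-1%:E)%E; exact: E.
Qed.

Definition coupling (mu mu' : probability (borel X) R) :
    set (probability (borel (X * X)%type) R) :=
  [set xi | (forall A, measurable A -> xi (A `*` setT) = mu A) /\
            (forall A, measurable A -> xi (setT `*` A) = mu' A)].

Definition W1 (mu mu' : probability (borel X) R) : \bar R :=
  ereal_inf [set (\int[xi]_z (mdist (z.1 : X) z.2)%:E)%E |
             xi in coupling mu mu'].

Definition coarse_ricci (nu : {measure set (borel X) -> \bar R}) (r : R)
    (x y : X) : \bar R :=
  (1 - W1 (random_walk nu r x) (random_walk nu r y) * (mdist x y)^-1%:E)%E.

Definition laplacian (nu : {measure set (borel X) -> \bar R}) (r : R)
    (f : X -> R) (x : X) : R :=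
  f x - \int[random_walk nu r x]_y f y.

(* The integrability requirement says that laplacian nu r f is defined on X. *)
Definition is_eigenvalue (nu : {measure set (borel X) -> \bar R}) (r : R)
    (lambda : R) :=
  exists f : X -> R,
    [/\ exists x, f x != 0,
        forall x, (random_walk nu r x).-integrable setT (EFin \o f) &
        forall x, laplacian nu r f x = lambda * f x].

(* Constant functions are eigenfunctions, so 0 is always an eigenvalue. *)
Lemma is_eigenvalue0 (nu : {measure set (borel X) -> \bar R}) (r : R) :
  is_eigenvalue nu r 0.
Proof.
exists (cst 1); split=> [|x|x]; first by exists point; rewrite oner_neq0.
- exact: finite_measure_integrable_cst.
- have P1 := @probability_setT _ _ _ (random_walk nu r x).
  rewrite /laplacian Rintegral_cst// mul0r mul1r.
  by rewrite [fine _](congr1 fine P1) subrr.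
Qed.

End random_walk.

(* Main.v *)
(* Write M g x for the mean of g over the r-ball at x, V x = nu (ball x r),
   mu = 1 - lambda and theta = 1 - kappa.  By the easy half of Kantorovich
   duality the curvature bound makes M multiply Lipschitz constants by at most
   theta, and by Fubini M is symmetric for the measure V nu.  If M f = mu f with
   mu <> 1, then f is V nu-orthogonal to the constants, so for every Lipschitz g
     |mu|^n |<f, g>| = |<f, M^n g>| = |<f, M^n g - M^n g (p)>| <= C theta^n.
   When theta < |mu| this forces <f, g> = 0 for all Lipschitz g, hence f = 0
   almost everywhere, and then everywhere because f = M f / mu. *)
Require Import Defs.
From HB Require Import structures.
From mathcomp Require Import all_boot all_order all_algebra.
From mathcomp Require Import all_classical all_reals all_analysis.
From mathcomp Require Import measurable_realfun.
From mathcomp Require Import ring lra.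

Import Order.TTheory GRing.Theory Num.Theory.
Import numFieldNormedType.Exports.
Local Open Scope classical_set_scope.
Local Open Scope ring_scope.

(** * Measurability tested on open sets *)

Section borel_measurability.

(** Open sets generate the target sigma-algebra, so they suffice as test sets. The case of interest
    is [borel (X * X)], generated by the opens of the product topology: couplings live there, and
    the projections are measurable by continuity. *)
Lemma open_preimage_borel_measurable (S : pointedType) (G : set (set S))
    (T : ptopologicalType) (f : S -> T) :
  (forall A, open A -> G (f @^-1` A)) ->
  measurable_fun setT (f : g_sigma_algebraType G -> borel T).
Proof.
move=> fG.
apply: (@measurability _ _ (g_sigma_algebraType G) (borel T) setT f (@open T)
  erefl).
by move=> _ [A oA <-]; rewrite setTI; apply: sub_sigma_algebra; exact: fG.
Qed.

Lemma open_preimage_real_measurable (R : realType) (S : pointedType)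
    (G : set (set S)) (f : S -> R) :
  (forall A, open A -> G (f @^-1` A)) ->
  measurable_fun setT (f : g_sigma_algebraType G -> R).
Proof.
move=> fG; apply: (measurability _ (RGenOpens.measurableE R)).
move=> _ [_ [a [b ->] <-]]; rewrite setTI; apply: sub_sigma_algebra.
exact/fG/interval_open.
Qed.

End borel_measurability.

(** * Lipschitz functions, distance to a set, and measurability of the distance *)

Section metric_lemmas.
Context {R : realType} {X : pmetricType R}.
Implicit Types (x y : X) (A : set X) (g : X -> R).

Lemma open_metric_ball x r : open (ball x r).
Proof.
rewrite openE => y /=; rewrite ballEmdist /= => xy.
apply/nbhs_ballP; exists (r - mdist x y); first by rewrite /= subr_gt0.
move=> z; rewrite ballEmdist /= ltrBrDl => yz.
by rewrite (le_lt_trans (metric_triangle x y z)).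
Qed.

Definition lipschitz_with (L : R) g :=
  forall x y, `|g x - g y| <= L * mdist x y.

Lemma lipschitz_with_continuous L g : lipschitz_with L g -> continuous g.
Proof.
move=> gL x; apply/cvgrPdist_lt => e e0.
(* [L] may be zero or negative; [|L| + 1] is a positive denominator in every case. *)
have L1 : 0 < `|L| + 1 by rewrite ltr_wpDl.
apply/nbhs_ballP; exists (e / (`|L| + 1)); first by rewrite /= divr_gt0.
move=> y; rewrite ballEmdist /= ltr_pdivlMr// => xy.
apply: le_lt_trans (gL x y) (le_lt_trans _ xy).
rewrite mulrC; apply: ler_wpM2l; first exact: mdist_ge0.
by rewrite (le_trans (ler_norm _))// lerDl.
Qed.

Lemma lipschitz_with_measurable L g :
  lipschitz_with L g -> measurable_fun setT (g : borel X -> R).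
Proof.
move=> /lipschitz_with_continuous/continuousP.
exact: open_preimage_real_measurable.
Qed.

(* Equals 0 when A is empty, hence the nonemptiness hypotheses below. *)
Definition set_dist A x : R := inf [set mdist x a | a in A].

Lemma set_dist_has_inf A x : A !=set0 -> has_inf [set mdist x a | a in A].
Proof.
move=> [a Aa]; split; first by exists (mdist x a), a.
by exists 0 => _ [b Ab <-]; exact: mdist_ge0.
Qed.

Lemma set_dist_le A x a : A a -> set_dist A x <= mdist x a.
Proof.
move=> Aa; apply: ge_inf; last by exists a.
by case: (@set_dist_has_inf A x) => //; exists a.
Qed.

Lemma lipschitz_set_dist A : A !=set0 -> lipschitz_with 1 (set_dist A).
Proof.
move=> A0.
have H x y : set_dist A x - set_dist A y <= mdist x y.
  rewrite lerBlDl -lerBlDr; apply: lb_le_inf.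
    by case: A0 => a Aa; exists (mdist y a), a.
  move=> _ [a Aa <-]; rewrite lerBlDr.
  rewrite (le_trans (set_dist_le A x a Aa))// addrC.
  exact: metric_triangle.
move=> x y; rewrite mul1r ler_norml H andbT lerNl opprB.
by rewrite metric_sym H.
Qed.

Lemma set_dist_eq0 A x : A x -> set_dist A x = 0.
Proof.
move=> Ax; apply/eqP; rewrite eq_le -{1}(mdistxx x) set_dist_le//=.
apply: lb_le_inf; first by exists (mdist x x), x.
by move=> _ [a Aa <-]; exact: mdist_ge0.
Qed.

Lemma set_dist_gt0 A x : A !=set0 -> open (~` A) -> ~ A x -> 0 < set_dist A x.
Proof.
move=> [a0 Aa0] oA Ax; have /nbhs_ballP[e /= e0 eA] : nbhs x (~` A).
  exact: open_nbhs_nbhs.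
apply: (lt_le_trans e0); apply: lb_le_inf; first by exists (mdist x a0), a0.
move=> _ [a Aa <-]; rewrite leNgt; apply/negP => xa.
by apply: (eA a) => //; rewrite ballEmdist.
Qed.

Lemma mdist_continuous : continuous (fun z : X * X => mdist z.1 z.2).
Proof.
move=> [x y]; apply/cvgrPdist_lt => e e0.
exists (ball x (e / 2), ball y (e / 2)) => /=.
  by split; apply: nbhsx_ballx; rewrite divr_gt0.
move=> [u v] /= []; rewrite !ballEmdist/= => xu yv.
rewrite ltr_norml.
have := metric_triangle x u y; have := metric_triangle u x v.
have := metric_triangle u v y; have := metric_triangle x y v.
by rewrite (metric_sym u x) (metric_sym v y); lra.
Qed.

Lemma compact_bounded_mdist : compact [set: X] ->
  exists D : R, 0 <= D /\ forall x y, mdist x y <= D.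
Proof.
move=> cX.
have cXX : compact [set: X * X] by rewrite -setXTT; exact: compact_setX.
have := continuous_compact (continuous_subspaceT mdist_continuous) cXX.
move=> /compact_bounded [M [_ MP]].
exists (`|M| + 1); split=> [|x y]; first by rewrite addr_ge0.
have /MP : M < `|M| + 1 by rewrite (le_lt_trans (ler_norm _))// ltrDl.
move=> /(_ (mdist x y)) /=; rewrite ger0_norm ?mdist_ge0//; apply.
by exists (x, y).
Qed.

(** Fubini works with the product sigma-algebra of [borel X * borel X], so openness in the product
    topology is not enough by itself. Separability turns the strip around the diagonal into a
    countable union of rectangles of balls. *)
Lemma measurable_mdist_lt (r : R) : separable_space X ->
  measurable ([set z | mdist (z.1 : X) z.2 < r] : set (borel X * borel X)).
Proof.
move=> [S [cS dS]].
have -> : [set z | mdist (z.1 : X) z.2 < r] =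
   \bigcup_(s in S) \bigcup_(q : rat)
     ((ball s (ratr q) : set (borel X)) `*`
      (ball s (r - ratr q) : set (borel X))).
  apply/seteqP; split => [[x y] /= xy|[x y] /= [s Ss [q _]] []]; last first.
    rewrite /= !ballEmdist /= => sx sy.
    by have := metric_triangle x s y; rewrite (metric_sym x s); lra.
  (* The slack is [2 * e]. With [s] within [e / 2] of [x] and [q] between [e / 2] and [e], the point
     [s] is within [q] of [x] and within [mdist x y + e <= r - q] of [y]. *)
  pose e := (r - mdist x y) / 2.
  have e0 : 0 < e by rewrite divr_gt0// subr_gt0.
  have [s [/= xs Ss]] : (ball x (e/2)) `&` S !=set0.
    apply: dS; first by exists x; apply: ballxx; rewrite divr_gt0.
    exact: open_metric_ball.
  have [q /andP[q1 q2]] : exists q : rat, e / 2 <= ratr q <= e.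
    have [|q] := @rat_in_itvoo R (e/2) e; first by lra.
    by rewrite in_itv /= => /andP[? ?]; exists q; rewrite !ltW.
  exists s => //; exists q => //; rewrite ballEmdist/= in xs.
  have := metric_triangle s x y; rewrite (metric_sym s x) => sxy.
  rewrite /e in q1 q2 xs.
  by split; rewrite /= ballEmdist /= ?(metric_sym s x); lra.
rewrite bigcup_set_type; apply: countable_bigcupT_measurable.
  by rewrite (eq_countable (card_setT _)).
move=> s; apply: bigcupT_measurable_rat => q.
by apply: measurableX; exact: measurable_open_ball.
Qed.

End metric_lemmas.

(** * Measure theory: vanishing on a pi-system, and Fubini for a symmetric relation *)

Section generic_integration.
Context d {T : measurableType d} {R : realType}.
Implicit Types (mu : {measure set T -> \bar R}) (f g : T -> R).

(** Bundles [nu] with the finite-measure structure that Fubini requires; stated as an equality so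
    that [nu] can be replaced everywhere by substitution. *)
Lemma finite_measure_ex (nu : {measure set T -> \bar R}) : (nu setT < +oo)%E ->
  exists mu : {finite_measure set T -> \bar R}, nu = mu.
Proof.
move=> nuT; have nu_fin : fin_num_fun nu.
  move=> A mA; rewrite ge0_fin_numE//; apply: le_lt_trans nuT.
  by apply: le_measure; rewrite ?inE.
have nu_sigma : sigma_finite setT nu.
  by apply: fin_num_fun_sigma_finite; rewrite ?measure0.
pose H1 := isFinite.Build _ _ _ _ nu_fin.
pose H2 := isSFinite.Build _ _ _ _ (sfinite_measure_sigma_finite nu_sigma).
pose H3 := isSigmaFinite.Build _ _ _ _ nu_sigma.
pose mu := HB.pack_for (FiniteMeasure.type T R) (Measure.sort nu) H1 H2 H3.
by exists mu; exact: eq_measure.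
Qed.

Lemma integrable_setU mu (A B : set T) (f : T -> \bar R) :
  measurable A -> measurable B ->
  mu.-integrable A f -> mu.-integrable B f -> mu.-integrable (A `|` B) f.
Proof.
move=> mA mB /integrableP[fA iA] fB.
have mBA : measurable (B `\` A) by exact: measurableD.
have /integrableP[fBA iBA] : mu.-integrable (B `\` A) f.
  exact: integrableS fB.
have mf : measurable_fun (A `|` (B `\` A)) f.
  exact/measurable_funU.
have -> : A `|` B = A `|` (B `\` A).
  by rewrite setDE setUIr setUCr setIT.
apply/integrableP; split => //.
rewrite ge0_integral_setU//; last 2 first.
- exact: measurableT_comp.
- by rewrite disj_set2E; apply/eqP; rewrite setDE setICA setICr setI0.
exact: lte_add_pinfty.
Qed.

Lemma integrable_bigsetU mu (I : Type) (s : seq I) (F : I -> set T)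
    (f : T -> \bar R) :
  (forall i, measurable (F i)) -> (forall i, mu.-integrable (F i) f) ->
  mu.-integrable (\big[setU/set0]_(i <- s) F i) f.
Proof.
move=> mF fF; elim: s => [|i s IH]; first by rewrite big_nil integrable_set0.
by rewrite big_cons; apply: integrable_setU => //; exact: bigsetU_measurable.
Qed.

(** The measurable sets over which [h] integrates to 0 form a Dynkin system: complements use the
    vanishing of the total integral, disjoint unions use countable additivity. The pi-lambda theorem
    extends this from [G] to all measurable sets. *)
Lemma pi_system_integral_eq0_ae mu (G : set (set T)) (h : T -> R) :
  @measurable _ T = <<s G >> -> setI_closed G ->
  mu.-integrable setT (EFin \o h) ->
  \int[mu]_x h x = 0 -> (forall A, G A -> \int[mu]_(x in A) h x = 0) ->
  ae_eq mu setT (EFin \o h) (cst 0%E).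
Proof.
move=> mG GI hi hT hG.
have mi (A : set T) : measurable A -> mu.-integrable A (EFin \o h).
  by move=> mA; exact: integrableS hi.
have fE (A : set T) : measurable A ->
    (\int[mu]_(x in A) (h x)%:E = (\int[mu]_(x in A) h x)%:E)%E.
  by move=> mA; rewrite /Rintegral fineK// integrable_fin_num//; exact: mi.
apply: integral_ae_eq => // E _ mE.
rewrite integral0 /= fE//; congr EFin.
move: (mE); rewrite mG; move: E {mE}.
apply: (dynkin_induction mG GI) => //.
- move=> S mS S0; move: hT; rewrite -(setUv S) Rintegral_setU//.
  + by rewrite S0 add0r.
  + exact: measurableC.
  + by rewrite setUv.
  + by rewrite disj_set2E setICr.
- move=> F mF tF F0; rewrite /Rintegral integral_bigcup//; last first.
    by apply: mi; exact: bigcupT_measurable.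
  by rewrite eseries0// => i _ _; rewrite fE// F0.
Qed.

(** Both sides are iterated integrals of [f x * g y] over the pairs related by [B]. For [B x] the
    [r]-ball at [x], this is the symmetry of averaging before normalization. *)
Lemma Rintegral_Fubini_symmetric (mu : {finite_measure set T -> \bar R})
    (B : T -> set T) (f g : T -> R) :
  measurable [set z : T * T | B z.1 z.2] -> (forall x y, B x y -> B y x) ->
  mu.-integrable setT (EFin \o f) ->
  measurable_fun setT g -> [bounded g x | x in setT] ->
  \int[mu]_x (f x * \int[mu]_(y in B x) g y) =
  \int[mu]_y (g y * \int[mu]_(x in B y) f x).
Proof.
move=> mB symB fi mg [M [_ gM]].
have mBx x : measurable (B x).
  rewrite (_ : B x = xsection [set z : T * T | B z.1 z.2] x).
    exact: measurable_xsection.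
  by apply/seteqP; split => y; rewrite /xsection/= ?inE.
have mf : measurable_fun setT f by apply/measurable_EFinP; case/integrableP: fi.
have bg x : `|g x| <= `|M| + 1.
  by apply: gM => //; rewrite (le_lt_trans (ler_norm _))// ltrDl.
have gi x : mu.-integrable (B x) (EFin \o g).
  apply: measurable_bounded_integrable => //.
  - by rewrite ltey_eq fin_num_measure.
  - exact: measurable_funTS.
  - by exists M; split; rewrite ?num_real// => y My z _; exact: gM.
have fiB x : mu.-integrable (B x) (EFin \o f) by exact: integrableS fi.
pose E := [set z : T * T | B z.1 z.2].
pose F (z : T * T) : \bar R := (f z.1 * g z.2 * \1_E z)%:E.
have mF : measurable_fun setT F.
  apply/measurable_EFinP; apply: measurable_funM; last exact: measurable_indic.
  by apply: measurable_funM; apply: measurableT_comp.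
have FM x y : (`|F (x, y)| <= (`|f x| * (`|M| + 1))%:E)%E.
  rewrite /F /= lee_fin !normrM -mulrA ler_wpM2l// -[leRHS]mulr1 ler_pM//.
  by rewrite indicE; case: (_ \in _); rewrite ?normr1 ?normr0.
(* [F] is dominated by [|f x| * (|M| + 1)], which is constant in [y]; its double integral is finite
   since [f] is integrable and [mu] is finite. *)
have Fi : (mu \x mu)%E.-integrable setT F.
  apply/integrable12ltyP => //.
  apply: (@le_lt_trans _ _
    (\int[mu]_x (`|f x| * (`|M| + 1) * fine (mu setT))%:E)%E).
    apply: ge0_le_integral => //.
    - by move=> x _; exact: integral_ge0.
    - apply: (measurable_fun_fubini_tonelli_F (abse \o F)) => //=.
      exact: measurableT_comp.
    - apply/measurable_EFinP; do 2 apply: measurable_funM => //.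
      exact: measurableT_comp.
    - move=> x _.
      apply: (@le_trans _ _ (\int[mu]_y (`|f x| * (`|M| + 1))%:E)%E).
        apply: ge0_le_integral => //.
        by apply: measurableT_comp => //; exact: measurableT_comp.
      by rewrite integral_cst// [leRHS]EFinM fineK// fin_num_measure.
  have : mu.-integrable setT
      (EFin \o (fun x => `|f x| * (`|M| + 1) * fine (mu setT))).
    pose c := (`|M| + 1) * fine (mu setT).
    have := integrableZr measurableT c (integrable_norm fi).
    by apply: eq_integrable => // x _; rewrite /= -EFinM mulrA.
  move/integrableP => [_]; under eq_integral.
    move=> x _; rewrite /= ger0_norm; last first.
      by rewrite !mulr_ge0// ?addr_ge0// fine_ge0.
    over.
  by [].
have := Fubini Fi.
rewrite /Rintegral => FF; apply: congr1.
rewrite [LHS](_ : _ = \int[mu]_x \int[mu]_y F (x, y))%E; last first.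
  apply: eq_integral => x _.
  rewrite EFinM /Rintegral fineK; last exact: integrable_fin_num.
  rewrite -integralZl//.
  rewrite integral_mkcond; apply: eq_integral => y _.
  rewrite /F /patch indicE /=; case: ifPn => [|] xy.
  - by rewrite (mem_set (_ : E (x, y))) ?mulr1 ?EFinM//; rewrite inE in xy.
  - rewrite notin_setE in xy.
    by rewrite (memNset (_ : ~ E (x, y))) ?mulr0.
rewrite FF; apply: eq_integral => y _.
rewrite EFinM /Rintegral fineK; last exact: integrable_fin_num.
rewrite -integralZl//.
rewrite [RHS]integral_mkcond; apply: eq_integral => x _.
rewrite /F /patch indicE /=; case: ifPn => [|] xy.
- rewrite (mem_set (_ : E (x, y))) ?mulr1 ?EFinM 1?muleC//.
  by rewrite inE in xy; exact: symB.
- rewrite notin_setE in xy.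
  by rewrite (memNset (_ : ~ E (x, y))) ?mulr0// => /symB.
Qed.

Lemma measurable_fine_measure_section (mu : {finite_measure set T -> \bar R})
    (B : T -> set T) : measurable [set z : T * T | B z.1 z.2] ->
  measurable_fun setT (fun x => fine (mu (B x))).
Proof.
move=> mB; apply: measurableT_comp => //.
have /= := measurable_fun_xsection mu mB.
congr (measurable_fun _ _); apply/funext => x /=; congr (mu _).
by rewrite /xsection; apply/seteqP; split => y /=; rewrite inE.
Qed.

End generic_integration.

(** * Lipschitz functions as a separating class of test functions *)

Section lipschitz_density.
Context {R : realType} {X : pmetricType R}.
Implicit Types (nu : {measure set (borel X) -> \bar R}).

(** Constants give a zero total integral. Indicators of open sets are limits of bounded Lipschitz
    functions, so by dominated convergence [h] integrates to 0 over every open set, and the open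
    sets form a generating pi-system. *)
Lemma lipschitz_orthogonal_ae nu (h : X -> R) :
  nu.-integrable setT (EFin \o h) ->
  (forall (L : R) (g : X -> R), 0 <= L -> lipschitz_with L g ->
    \int[nu]_x (h x * g x) = 0) ->
  ae_eq nu setT (EFin \o h) (cst 0%E).
Proof.
move=> hi h0.
have hT : \int[nu]_x h x = 0.
  rewrite -[RHS](h0 0 (cst 1))//; last first.
    by move=> x y; rewrite subrr normr0 mul0r.
  by apply: eq_Rintegral => x _; rewrite mulr1.
apply: (@pi_system_integral_eq0_ae _ _ _ nu (@open X)) => //.
  exact: openI.
move=> U oU.
(* The whole space is treated apart: its complement is empty, and [set_dist] would take its default
   value 0 there. *)
have [->//|/eqP UT] := eqVneq U setT.
pose C : set X := ~` U.
have U0 : C !=set0 by apply/set0P/eqP => /(congr1 setC); rewrite setCK setC0.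
(* Lipschitz functions converging pointwise to the indicator of U *)
pose phi (n : nat) (x : X) : R := Num.min 1 (n%:R * set_dist C x).
have phi01 n x : 0 <= phi n x <= 1.
  rewrite /phi le_min ler01/= ge_min lexx/= andbT mulr_ge0//.
  apply: lb_le_inf; first by case: U0 => a Ua; exists (mdist x a), a.
  by move=> _ [a Aa <-]; exact: mdist_ge0.
have phiL n : lipschitz_with n%:R (phi n).
  move=> x y; have := lipschitz_set_dist C U0 x y; rewrite mul1r => dxy.
  have : `|n%:R * set_dist C x - n%:R * set_dist C y| <= n%:R * mdist x y.
    by rewrite -mulrBr normrM ger0_norm// ler_wpM2l.
  rewrite /phi !ler_norml; set a := n%:R * _ x; set b := n%:R * _ y.
  have : 0 <= n%:R * mdist x y by rewrite mulr_ge0// mdist_ge0.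
  move=> d0 /andP[ab ba]; apply/andP.
  by rewrite /Num.min; case: ltP => ?; case: ltP => ?; split; lra.
have mphi n : measurable_fun setT (phi n : borel X -> R).
  exact: lipschitz_with_measurable (phiL n).
have mh : measurable_fun setT (h : borel X -> R).
  by apply/measurable_EFinP; case/integrableP : hi.
have mU : measurable (U : set (borel X)) by exact: sub_sigma_algebra.
have [|||||_ _ cv] := @dominated_convergence _ _ _ nu setT measurableT
  (fun n x => (h x * phi n x)%:E) (fun x => (h x * \1_U x)%:E)
  (fun x => `|h x|%:E).
- by move=> n; apply/measurable_EFinP; exact: measurable_funM.
- by apply/measurable_EFinP; apply: measurable_funM.
- apply: aeW => x _; apply: cvg_EFin; first exact: nearW.
  (* The sequence is eventually constant: outside [U] all terms vanish, and inside [U] one has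
     [phi n x = 1] once [n >= 1 / set_dist C x]. *)
  apply: cvg_near_cst; have [xU|xU] := pselect (U x); last first.
    apply: nearW => n /=; rewrite indicE memNset//.
    by rewrite /phi set_dist_eq0// mulr0 min_r.
  have dx : 0 < set_dist C x by apply: set_dist_gt0; rewrite // /C setCK.
  near=> n; rewrite /= indicE mem_set// /phi min_l// -ler_pdivrMr//.
  by near: n; exact: nbhs_infty_ger.
- exact: integrable_norm.
- apply: aeW => x n _; rewrite lee_fin normrM -[leRHS]mulr1 ler_wpM2l//.
  by have /andP[p0 p1] := phi01 n x; rewrite ger0_norm.
have hn n : (\int[nu]_x (h x * phi n x)%:E = 0)%E.
  rewrite -[LHS]fineK ?(h0 n%:R)//.
    by rewrite -[RHS]/(0%:E) -(h0 n%:R (phi n)).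
  apply: integrable_fin_num => //.
  apply: le_integrable (integrable_norm hi) => //.
    by apply/measurable_EFinP; exact: measurable_funM.
  move=> x _; rewrite lee_fin normrM normr_id -[leRHS]mulr1 ler_wpM2l//.
  by have /andP[p0 p1] := phi01 n x; rewrite ger0_norm.
rewrite Rintegral_mkcond /Rintegral.
rewrite (eq_integral (fun x : borel X => (h x * \1_U x)%:E)).
  rewrite -(cvg_lim _ cv)// (_ : (fun n => _) = cst 0%E) ?lim_cst//.
  exact/funext.
move=> x _; rewrite /patch indicE.
by case: ifPn => xU; rewrite ?mulr1 ?mulr0.
Unshelve. all: by end_near.
Qed.

End lipschitz_density.

(** * The easy half of Kantorovich duality *)

Section kantorovich.
Context {R : realType} {X : pmetricType R}.
Implicit Types (mu : probability (borel X) R).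

(** Integrate [|g x - g y| <= L * mdist x y] against a coupling of nearly optimal cost. The infimum
    is not assumed to be attained, hence an arbitrary error [e]; the bound [M] makes [g]
    integrable. *)
Lemma kantorovich_le mu mu' (L w : R) (g : X -> R) (M : R) :
  0 <= L -> lipschitz_with L g -> (forall x, `|g x| <= M) ->
  (W1 mu mu' <= w%:E)%E ->
  `|\int[mu]_x g x - \int[mu']_x g x| <= L * w.
Proof.
move=> L0 gL gM Ww.
have mg := lipschitz_with_measurable _ _ gL.
have m1 : measurable_fun setT (fst : borel (X * X)%type -> borel X).
  apply: open_preimage_borel_measurable; apply/continuousP => z.
  exact: cvg_fst.
have m2 : measurable_fun setT (snd : borel (X * X)%type -> borel X).
  apply: open_preimage_borel_measurable; apply/continuousP => z.
  exact: cvg_snd.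
have md : measurable_fun setT
    ((fun z => mdist z.1 z.2) : borel (X * X)%type -> R).
  apply: open_preimage_real_measurable; apply/continuousP.
  exact: mdist_continuous.
have bi d (T : measurableType d) (P : probability T R) (k : T -> R) :
    measurable_fun setT k -> (forall x, `|k x| <= M) ->
    P.-integrable setT (EFin \o k).
  move=> mk kM; apply: measurable_bounded_integrable => //.
    by rewrite ltey_eq fin_num_measure.
  exists M; split; rewrite ?num_real// => y My z _.
  exact: le_trans (kM z) (ltW My).
(* The marginal condition says that [P] is the pushforward of [xi] along the projection [p], so this
   is a change of variables. *)
have marg (xi : probability (borel (X * X)%type) R)
    (P : probability (borel X) R) (p : borel (X * X)%type -> borel X) :
    measurable_fun setT p ->
    (forall A, measurable A -> xi (p @^-1` A) = P A) ->
    \int[P]_x g x = \int[xi]_z g (p z).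
  move=> mp pP; rewrite /Rintegral; congr fine.
  rewrite [LHS](eq_measure_integral (pushforward xi p)); last first.
    by move=> A mA _; exact: esym (pP A mA).
  rewrite integral_pushforward//.
    exact/measurable_EFinP.
  apply: (bi _ _ xi (g \o p)); first exact: (measurableT_comp mg mp).
  by move=> z; exact: gM.
apply/ler_addgt0Pr => e e0.
(* Dividing by [L + 1] covers [L = 0] and still gives [L * e' <= e]. *)
pose e' := e / (L + 1).
have e'0 : 0 < e' by rewrite divr_gt0// ltr_wpDl.
have : (W1 mu mu' < (w + e')%:E)%E.
  by rewrite (le_lt_trans Ww)// lte_fin ltrDl.
move=> /ereal_inf_lt [_ [xi [xi1 xi2] <-]] xiw.
have -> : \int[mu]_x g x = \int[xi]_z g z.1.
  apply: marg => // A mA; rewrite -xi1//; congr (xi _).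
  by apply/seteqP; split => z; [move=> ?; split|case].
have -> : \int[mu']_x g x = \int[xi]_z g z.2.
  apply: marg => // A mA; rewrite -xi2//; congr (xi _).
  by apply/seteqP; split => z; [move=> ?; split|case].
have gi1 : xi.-integrable setT (EFin \o (fun z => g z.1)).
  by apply: bi => [|z]; [exact: (measurableT_comp mg m1)|exact: gM].
have gi2 : xi.-integrable setT (EFin \o (fun z => g z.2)).
  by apply: bi => [|z]; [exact: (measurableT_comp mg m2)|exact: gM].
have di : xi.-integrable setT (EFin \o (fun z => mdist z.1 z.2)).
  apply/integrableP; split; first exact/measurable_EFinP.
  rewrite (eq_integral (fun z : borel (X * X)%type => (mdist z.1 z.2)%:E)).
    exact: lt_trans xiw (ltry _).
  by move=> z _ /=; rewrite ger0_norm// mdist_ge0.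
have gi12 : xi.-integrable setT (EFin \o (fun z => g z.1 - g z.2)).
  exact: (integrableB measurableT gi1 gi2).
rewrite -RintegralB//.
apply: (le_trans (le_normr_Rintegral _ _)) => //.
apply: (@le_trans _ _ (\int[xi]_z (L * mdist z.1 z.2))).
  apply: le_Rintegral => //.
  - exact: (integrable_norm gi12).
  - exact: (integrableZl measurableT L di).
rewrite RintegralZl//.
apply: (@le_trans _ _ (L * (w + e'))).
  apply: ler_wpM2l => //; rewrite -lee_fin /Rintegral fineK; first exact: ltW.
  exact: integrable_fin_num di.
rewrite mulrDr lerD2l /e' mulrC -mulrA ger_pMr// mulrC ler_pdivrMr ?ltr_wpDl//.
by rewrite mul1r lerDl.
Qed.

End kantorovich.

(** * Integrals against the random walk as normalized integrals over balls *)

Section random_walk_integral.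
Context {R : realType} {X : pmetricType R}.
Variables (nu : {measure set (borel X) -> \bar R}) (r : R) (x : X).
Hypothesis nu_gt0 : (0 < nu (ball x r))%E.
Hypothesis nu_lty : (nu (ball x r) < +oo)%E.

Let mB : measurable (ball x r : set (borel X)) := measurable_open_ball x r.
Let V := fine (nu (ball x r)).

Let V_gt0 : 0 < V.
Proof. by rewrite /V fine_gt0// nu_gt0 nu_lty. Qed.

(** On subsets of the ball the walk is [nu] scaled by [V^-1], and on subsets of its complement it is
    the zero measure; the domain is split accordingly. *)
Lemma ge0_integral_random_walk (f : borel X -> \bar R) :
  measurable_fun setT f -> (forall y, (0 <= f y)%E) ->
  (\int[random_walk nu r x]_y f y = V^-1%:E * \int[nu]_(y in ball x r) f y)%E.
Proof.
move=> mf f0.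
have mBc : measurable (~` ball x r : set (borel X)) by exact: measurableC.
have k0 : 0 <= V^-1 by rewrite invr_ge0 ltW.
rewrite -(setUv (ball x r)) ge0_integral_setU//; last 2 first.
- by rewrite setUv.
- by rewrite disj_set2E setICr.
rewrite [X in (_ + X)%E](_ : _ = 0%E) ?adde0.
  rewrite (eq_measure_integral (mscale (NngNum k0) nu)).
    rewrite ge0_integral_mscale//; exact: measurable_funTS.
  move=> A mA AB; apply: (etrans (random_walkE _ _ _)) => //.
  by rewrite (setIidl AB) muleC.
rewrite (eq_measure_integral mzero) ?integral_measure_zero//.
move=> A mA AB; apply: (etrans (random_walkE _ _ _)) => //.
rewrite (_ : A `&` _ = set0) ?measure0 ?mul0e//.
by rewrite -subset0 => y [/AB].
Qed.

Lemma integrable_random_walk (f : borel X -> R) :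
  measurable_fun setT f ->
  (random_walk nu r x).-integrable setT (EFin \o f) <->
  nu.-integrable (ball x r) (EFin \o f).
Proof.
move=> mf.
have mf' : measurable_fun setT (fun y => `|(f y)%:E|%E).
  by apply: measurableT_comp => //; exact/measurable_EFinP.
have V'0 : (0 < V^-1%:E)%E by rewrite lte_fin invr_gt0.
split=> /integrableP[_ fi]; apply/integrableP; split.
- by apply: measurable_funTS; exact/measurable_EFinP.
- move: fi; rewrite ge0_integral_random_walk//.
  case: (integral _ _ _) => [s _||_]; rewrite ?ltry ?ltNyr//.
  by rewrite gt0_muley.
- exact/measurable_EFinP.
- by rewrite ge0_integral_random_walk// lte_mul_pinfty// ltW.
Qed.

Lemma Rintegral_random_walk (f : borel X -> R) :
  measurable_fun setT f -> nu.-integrable (ball x r) (EFin \o f) ->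
  \int[random_walk nu r x]_y f y = V^-1 * \int[nu]_(y in ball x r) f y.
Proof.
move=> mf fi.
have mfE : measurable_fun setT (EFin \o f) by exact/measurable_EFinP.
rewrite /Rintegral integralE [in RHS]integralE.
rewrite !ge0_integral_random_walk//;
  [|exact: measurable_funeneg|exact: measurable_funepos].
have ip := integrable_fin_num mB (integrable_funepos mB fi).
have im := integrable_fin_num mB (integrable_funeneg mB fi).
rewrite -muleBr//; last by rewrite fin_num_adde_defr// fin_numN.
by rewrite fineM// fin_numB ip im.
Qed.

End random_walk_integral.

(** * Eigenfunctions of the averaging operator and the decay of Lipschitz constants *)

Section spectral_bound.
Context {R : realType} {X : pmetricType R}.
Variables (nu : {finite_measure set (borel X) -> \bar R}) (r theta D : R).
Hypothesis sepX : separable_space X.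
Hypothesis nu_gt0 : forall x, (0 < nu (ball x r))%E.
Hypothesis D_ge0 : 0 <= D.
Hypothesis diamX : forall x y : X, mdist x y <= D.
Hypothesis theta_ge0 : 0 <= theta.

Let M (g : X -> R) (x : X) := \int[random_walk nu r x]_y g y.
Let V (x : X) := fine (nu (ball x r)).

(** The form in which the curvature bound enters, with [theta] standing for [1 - kappa]; Kantorovich
    duality supplies it. *)
Hypothesis lipM : forall L g, 0 <= L -> lipschitz_with L g ->
  lipschitz_with (theta * L) (M g).

Let nu_lty x : (nu (ball x r) < +oo)%E.
Proof. by rewrite ltey_eq fin_num_measure//; exact: measurable_open_ball. Qed.

Let V_gt0 x : 0 < V x.
Proof. by rewrite /V fine_gt0// nu_gt0 nu_lty. Qed.

Let mE : measurable [set z : borel X * borel X | (ball (z.1 : X) r) z.2].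
Proof.
rewrite (_ : [set _ | _] = [set z | mdist (z.1 : X) z.2 < r]).
  exact: (measurable_mdist_lt r sepX).
by apply/seteqP; split => z /=; rewrite ballEmdist.
Qed.

Lemma lipschitz_bounded (L : R) (g : X -> R) (p x : X) : 0 <= L ->
  lipschitz_with L g -> `|g x| <= `|g p| + L * D.
Proof.
move=> L0 gL; rewrite -[g x](subrK (g p)) addrC.
apply: (le_trans (ler_normD _ _)); rewrite lerD2l.
by apply: (le_trans (gL _ _)); rewrite ler_wpM2l.
Qed.

Let lip_bounded (L : R) (g : X -> R) (A : set X) : 0 <= L ->
  lipschitz_with L g -> [bounded g x | x in A].
Proof.
move=> L0 gL; exists (`|g point| + L * D); split; first exact: num_real.
move=> y My x _; apply: le_trans (ltW My).
exact: lipschitz_bounded.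
Qed.

Variables (f : X -> R) (mu : R).
Hypothesis fi : nu.-integrable setT (EFin \o f).
Hypothesis Mf : forall x, M f x = mu * f x.

Let mf : measurable_fun setT (f : borel X -> R).
Proof. by apply/measurable_EFinP; case/integrableP : fi. Qed.

(** Integrating against [h] and [nu] is pairing with [f] in the measure of density [V], for which
    [M] is symmetric. *)
Let h (x : X) := f x * V x.

Let mV : measurable_fun setT (V : borel X -> R).
Proof. exact: measurable_fine_measure_section mE. Qed.

Let hi : nu.-integrable setT (EFin \o h).
Proof.
apply: (integrableMl measurableT fi mV).
exists (fine (nu setT)); split; first exact: num_real.
move=> y My x _; apply: le_trans (ltW My).
rewrite /= (ger0_norm (ltW (V_gt0 x))) /V; apply: fine_le.
- by rewrite fin_num_measure//; exact: measurable_open_ball.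
- by rewrite fin_num_measure.
by apply: le_measure; rewrite ?inE//; exact: measurable_open_ball.
Qed.

Let hgi (L : R) (g : X -> R) : 0 <= L -> lipschitz_with L g ->
  nu.-integrable setT (EFin \o (fun x => h x * g x)).
Proof.
move=> L0 gL; apply: (integrableMl measurableT hi).
- exact: lipschitz_with_measurable gL.
- exact: lip_bounded gL.
Qed.

Let MfE x : M f x = (V x)^-1 * \int[nu]_(y in ball x r) f y.
Proof.
apply: (Rintegral_random_walk _ _ _ (nu_gt0 x) (nu_lty x) _ mf).
by apply: integrableS fi => //; exact: measurable_open_ball.
Qed.

(** The factor [V] in [h] cancels the normalization of [M g]. Symmetric Fubini then moves the
    average onto [f], where the eigenvalue equation turns the integral over the ball at [y] into
    [mu * h y]. *)
Let transfer (L : R) (g : X -> R) : 0 <= L -> lipschitz_with L g ->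
  \int[nu]_x (h x * M g x) = mu * \int[nu]_x (h x * g x).
Proof.
move=> L0 gL; have mg := lipschitz_with_measurable _ _ gL.
have gi x : nu.-integrable (ball x r) (EFin \o g).
  apply: measurable_bounded_integrable; [exact: measurable_open_ball|
    exact: nu_lty|exact: measurable_funTS|exact: lip_bounded gL].
rewrite -RintegralZl//; last exact: hgi gL.
transitivity (\int[nu]_x (f x * \int[nu]_(y in ball x r) g y)).
  apply: eq_Rintegral => x _.
  rewrite /h /M (Rintegral_random_walk _ _ _ (nu_gt0 x) (nu_lty x) _ mg (gi x)).
  by rewrite mulrA mulfK// gt_eqF.
have bs (x y : X) : ball x r y -> ball y r x by exact: ball_sym.
have bg : [bounded g x | x in [set: X]] by exact: lip_bounded gL.
rewrite (@Rintegral_Fubini_symmetric _ _ _ nu _ f g mE bs fi mg bg).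
apply: eq_Rintegral => y _.
have := Mf y; rewrite MfE.
move=> /(congr1 (fun t => V y * t)).
by rewrite mulVKf ?gt_eqF// => ->; rewrite /h; ring.
Qed.

Lemma random_walk_eigenfunction_eq0 : mu != 1 -> theta < `|mu| ->
  forall x, f x = 0.
Proof.
move=> mu1 thmu.
have mu0 : 0 < `|mu| by exact: le_lt_trans thmu.
(* Since [M] fixes the constant 1, [transfer] shows that this integral equals [mu] times itself, and
   [mu != 1]. *)
have h0 : \int[nu]_x h x = 0.
  have L1 : lipschitz_with 0 (cst 1 : X -> R).
    by move=> x y; rewrite subrr normr0 mul0r.
  have M1 x : M (cst 1) x = 1.
    rewrite /M Rintegral_cst// mul1r.
    exact: (congr1 fine (probability_setT (random_walk nu r x))).
  have := transfer 0 _ (lexx 0) L1.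
  rewrite (@eq_Rintegral _ _ _ nu _ h); last by move=> x _; rewrite M1 mulr1.
  rewrite (@eq_Rintegral _ _ _ nu _ h (fun x => h x * cst 1 x)); last first.
    by move=> x _; rewrite mulr1.
  move=> /eqP; rewrite -subr_eq0 -{1}[Rintegral _ _ _]mul1r -mulrBl mulf_eq0.
  by rewrite subr_eq0 eq_sym (negbTE mu1)/= => /eqP.
have iterL (L : R) g n : 0 <= L -> lipschitz_with L g ->
    lipschitz_with (theta ^+ n * L) (iter n M g).
  move=> L0 gL; elim: n => [|n IH]; first by rewrite mul1r.
  by rewrite exprS -mulrA; apply: lipM => //; rewrite mulr_ge0// exprn_ge0.
have iterI (L : R) g n : 0 <= L -> lipschitz_with L g ->
    \int[nu]_x (h x * iter n M g x) = mu ^+ n * \int[nu]_x (h x * g x).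
  move=> L0 gL; elim: n => [|n IH]; first by rewrite mul1r.
  rewrite iterS (transfer (theta ^+ n * L))//.
  - by rewrite IH exprS mulrA.
  - by rewrite mulr_ge0// exprn_ge0.
  - exact: iterL.
have hae : ae_eq nu setT (EFin \o h) (cst 0%E).
  apply: lipschitz_orthogonal_ae => // L g L0 gL.
  set I := \int[nu]_x _.
  (* [L * D] bounds the oscillation of [g], as distances are at most [D]. *)
  pose C := \int[nu]_x `|h x| * (L * D).
  have C0 : 0 <= C by rewrite mulr_ge0 ?mulr_ge0//; exact: Rintegral_ge0.
  have bound n : `|I| <= C * (theta / `|mu|) ^+ n.
    rewrite expr_div_n mulrA ler_pdivlMr ?exprn_gt0//.
    rewrite -normrX -normrM mulrC /I -(iterI L)//.
    set gn := iter n M g; pose c := gn point.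
    have Ln0 : 0 <= theta ^+ n * L by rewrite mulr_ge0// exprn_ge0.
    have gnL : lipschitz_with (theta ^+ n * L) gn by exact: iterL.
    have gcL : lipschitz_with (theta ^+ n * L) (fun x => gn x - c).
      by move=> x y; rewrite opprB addrA subrK.
    have hci : nu.-integrable setT (EFin \o (fun x => h x * c)).
      exact: (integrableZr measurableT c hi).
    (* Subtracting a constant is free because [h] has zero integral. The function [gn - c] vanishes
       at [point], so it is bounded by [theta ^+ n * L * D]. *)
    have -> : \int[nu]_x (h x * gn x) = \int[nu]_x (h x * (gn x - c)).
      transitivity (\int[nu]_x (h x * gn x - h x * c)).
        rewrite RintegralB//; last exact: hgi gnL.
        by rewrite RintegralZr// h0 mul0r subr0.
      by apply: eq_Rintegral => x _; rewrite mulrBr.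
    apply: (le_trans (le_normr_Rintegral _ _)) => //; first exact: hgi gcL.
    rewrite /C -mulrA -RintegralZr//; last exact: integrable_norm.
    apply: le_Rintegral => //.
    - by apply: (integrable_norm _); exact: hgi gcL.
    - exact: (integrableZr measurableT _ (integrable_norm hi)).
    - move=> x _; rewrite normrM ler_wpM2l//.
      apply: (le_trans (gnL _ _)).
      by rewrite [leRHS]mulrC mulrA ler_wpM2l.
  have q1 : `|theta / `|mu| | < 1.
    by rewrite ger0_norm ?divr_ge0// ltr_pdivrMr// mul1r.
  have cv : (fun n => C * (theta / `|mu|) ^+ n) @ \oo --> C * 0.
    by apply: cvgMr; exact: cvg_expr.
  apply/normr0_eq0/eqP; rewrite eq_le normr_ge0 andbT.
  rewrite -(mulr0 C) -(cvg_lim _ cv)//.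
  by apply: limr_ge; [apply/cvg_ex; eexists; exact: cv|exact: nearW].
(* From almost everywhere to everywhere: [mu * f x] is an average of [f] over a ball, which ignores
   null sets, and [h y = 0] gives [f y = 0] because [V y > 0]. *)
move=> x; apply: (@mulfI _ mu); first by rewrite -normr_gt0.
rewrite mulr0 -Mf MfE.
rewrite /Rintegral (ae_eq_integral (cst 0%E)) ?integral0 ?mulr0//.
- exact: measurable_open_ball.
- by apply: measurable_funTS; exact/measurable_EFinP.
- apply: filterS hae => y /= hy _; have := hy Logic.I.
  by move=> [/eqP]; rewrite mulf_eq0 (gt_eqF (V_gt0 y)) orbF => /eqP ->.
Qed.

End spectral_bound.

(** * Global integrability by compactness, and the curvature bound as a transport bound *)

Section coarse_ricci.
Context {R : realType} {X : pmetricType R}.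
Variables (nu : {measure set (borel X) -> \bar R}) (r kappa : R).

(** An eigenfunction is only known to be integrable on each [r]-ball; finitely many of these balls
    cover a compact space. *)
Lemma compact_ball_integrable (f : borel X -> \bar R) : compact [set: X] ->
  0 < r -> (forall x : X, nu.-integrable (ball x r) f) ->
  nu.-integrable setT f.
Proof.
move=> cX r0 fB.
move: cX; rewrite compact_cover => /(_ X setT (fun x => ball x r)).
case=> [x _|x _|s _ sX];
  [exact: open_metric_ball|by exists x => //; exact: ballxx|].
have -> : [set: borel X] =
    \big[setU/set0]_(x <- finmap.enum_fset s) (ball x r : set (borel X)).
  by apply/seteqP; split => // x _; rewrite -bigcup_fset; exact: sX.
by apply: integrable_bigsetU => // x; exact: measurable_open_ball.
Qed.

Lemma W1_ge0 (mu mu' : probability (borel X) R) : (0 <= W1 mu mu')%E.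
Proof.
apply: le_ereal_inf_tmp => _ [xi _ <-]; apply: integral_ge0 => z _.
by rewrite lee_fin mdist_ge0.
Qed.

(** Nonnegativity of [W1] caps the curvature at 1, so one pair of distinct points already forces
    [kappa <= 1]. *)
Lemma coarse_ricci_ge (x y : X) : x != y ->
  (kappa%:E <= coarse_ricci nu r x y)%E ->
  0 <= 1 - kappa /\
  (W1 (random_walk nu r x) (random_walk nu r y) <=
    ((1 - kappa) * mdist x y)%:E)%E.
Proof.
rewrite -mdist_gt0 /coarse_ricci => xy.
have := W1_ge0 (random_walk nu r x) (random_walk nu r y).
case: (W1 _ _) => [w w0||]//; last first.
  (* An infinite [W1] would make the curvature [-oo], which is not at least [kappa]. *)
  by move=> _; rewrite gt0_mulye ?lte_fin ?invr_gt0.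
rewrite -EFinM -EFinB !lee_fin in w0 * => kw.
have : w / mdist x y <= 1 - kappa by lra.
split; last by rewrite -ler_pdivrMr.
by apply: le_trans H; rewrite divr_ge0// ltW.
Qed.

End coarse_ricci.

(* Constant functions make 0 an eigenvalue (is_eigenvalue0), so for
   0 < kappa the claim is about the nonzero eigenvalues. *)
Theorem corollary1p10 (R : realType) (X : pmetricType R)
  (nu : {measure set (borel X) -> \bar R}) (r kappa : R)
  (hX : metric_measure_space nu)
  (hcompact : compact [set: X])
  (hgeodesic : geodesic_space X)
  (hr : 0 < r)
  (hkappa : forall x y : X, x != y -> (kappa%:E <= coarse_ricci nu r x y)%E)
  (hBG : exists K N : R, 1 < N /\ bishop_gromov nu K N)
  (lambda : R) (hlambda : is_eigenvalue nu r lambda)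
  (hlambda0 : 0 < kappa -> lambda != 0) :
  kappa <= lambda <= 2 - kappa.
Proof.
case: hX => _ sepX [nuC _] nuB.
have [mu nuE] := finite_measure_ex _ _ (nuC _ hcompact).
subst nu.
(* For [lambda = 0] both inequalities follow from [kappa <= 0], which is the contrapositive of
   [hlambda0]. *)
have [lambda0|lambda_neq0] := eqVneq lambda 0.
  suff : kappa <= 0 by rewrite lambda0; lra.
  by rewrite leNgt; apply/negP => /hlambda0; rewrite lambda0 eqxx.
case: hlambda => f [[p fp] fi fE].
have nu_lty x : (mu (ball x r) < +oo)%E by have [] := nuB x r hr.
have nu_gt0 x : (0 < mu (ball x r))%E by have [] := nuB x r hr.
(* On a one-point space [f] is constant, so its Laplacian vanishes and [lambda * f p = 0], a
   contradiction. Otherwise a distinct pair yields [0 <= 1 - kappa]. *)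
have [[x [y xy]]|X1] := pselect (exists x y : X, x != y); last first.
  have fcst x : f x = f p.
    apply: contrapT => fxp; apply: X1; exists x, p.
    by apply/eqP => xp; rewrite xp in fxp.
  move/eqP: (fE p); rewrite /laplacian.
  rewrite (@eq_Rintegral _ _ _ _ _ (cst (f p))); last first.
    by move=> x _; rewrite fcst.
  rewrite Rintegral_cst//.
  rewrite [fine _](congr1 fine (probability_setT (random_walk mu r p))).
  by rewrite mulr1 subrr eq_sym mulf_eq0 (negbTE lambda_neq0) (negbTE fp).
have [theta0 _] := coarse_ricci_ge mu r kappa x y xy (hkappa _ _ xy).
have mf : measurable_fun setT (f : borel X -> R).
  by apply/measurable_EFinP; exact: measurable_int (fi p).
have [D [D0 diamX]] := compact_bounded_mdist hcompact.
have fnu : mu.-integrable setT (EFin \o f).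
  apply: (compact_ball_integrable mu r) => // z.
  exact: (integrable_random_walk mu r z (nu_gt0 z) (nu_lty z) f mf).1 (fi z).
have lipM L g : 0 <= L -> lipschitz_with L g ->
    lipschitz_with ((1 - kappa) * L) (fun x => \int[random_walk mu r x]_y g y).
  move=> L0 gL u v; have [->|uv] := eqVneq u v.
    by rewrite subrr normr0 mulr_ge0 ?mdist_ge0// mulr_ge0.
  have [_ W1uv] := coarse_ricci_ge mu r kappa u v uv (hkappa _ _ uv).
  rewrite -mulrA mulrCA.
  apply: (@kantorovich_le _ _ _ _ L _ _ (`|g p| + L * D)) => // z.
  exact: lipschitz_bounded.
have muE z : \int[random_walk mu r z]_y f y = (1 - lambda) * f z.
  have := fE z; rewrite /laplacian mulrBl mul1r => <-.
  by rewrite opprB addrC subrK.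
(* The two bounds together say exactly this. If it failed, the decay argument with eigenvalue
   [1 - lambda], different from 1 as [lambda != 0], would give [f p = 0]. *)
suff : `|1 - lambda| <= 1 - kappa by rewrite ler_norml; lra.
rewrite leNgt; apply/negP => thmu.
have := @random_walk_eigenfunction_eq0 _ _ mu r (1 - kappa) D sepX nu_gt0 D0
  diamX theta0 lipM f (1 - lambda) fnu muE _ thmu p.
rewrite -subr_eq0 addrAC subrr add0r oppr_eq0 => /(_ lambda_neq0)/eqP.
by rewrite (negbTE fp).
Qed.
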